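(* Let $t>0$ and let $S(\cdot,t)\colon\mathbb{R}^n\to\mathbb{R}$ be a reachable function. Put $\psi(\bm{x},t)=\frac12\|\bm{x}\|_2^2-tS(\bm{x},t)$ and let $J_{\mathrm{BVS}}$ be the backward viscosity solution prior associated with $S(\cdot,t)$ (reachability and $J_{\mathrm{BVS}}$ are defined in the context). Let $B\subset\mathbb{R}^n$ and $\hat\psi\colon\mathbb{R}^n\to\mathbb{R}$ satisfy $$\varepsilon_{\psi}(t):=\sup_{\bm{x}\in B}\left|\hat\psi(\bm{x})-\psi(\bm{x},t)\right|<+\infty .$$ Fix $\bm{y}\in\mathbb{R}^n$ and suppose that $\bm{x}\mapsto\langle\bm{x},\bm{y}\rangle-\psi(\bm{x},t)$ attains its supremum over $\mathbb{R}^n$ at some $\bm{x}^*\in B$, and that $\bm{x}\mapsto\langle\bm{x},\bm{y}\rangle-\hat\psi(\bm{x})$ attains its supremum over $\mathbb{R}^n$ at some $\hat{\bm{x}}\in B$. Then the function $\hat J:=\frac1t\left(\hat\psi^*-\frac12\|\cdot\|_2^2\right)$ satisfies $$\left|\hat J(\bm{y})-J_{\mathrm{BVS}}(\bm{y})\right|\leqslant\frac1t\max\left\{\left|\hat\psi(\bm{x}^* )-\psi(\bm{x}^*,t)\right|,\ \left|\hat\psi(\hat{\bm{x}})-\psi(\hat{\bm{x}},t)\right|\right\}\leqslant\frac{\varepsilon_\psi(t)}{t}.$$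
   Context: For $t>0$ and a function $S(\cdot,t)\colon\mathbb{R}^n\to\mathbb{R}$, let $I_t(S)$ be the set of uniformly Lipschitz continuous functions $J\colon\mathbb{R}^n\to\mathbb{R}$ such that $S(\cdot,t)$ is the value at time $t$ of the unique viscosity solution of the Hamilton--Jacobi initial value problem $\partial_t S+\frac12\|\nabla_{\bm{x}}S\|_2^2=0$ on $\mathbb{R}^n\times(0,+\infty)$, $S(\cdot,0)=J$. This viscosity solution is given by the Lax--Oleinik formula, so $J\in I_t(S)$ means that $J$ is uniformly Lipschitz continuous and $$S(\bm{x},t)=\inf_{\bm{y}\in\mathbb{R}^n}\left\{\tfrac{1}{2t}\|\bm{x}-\bm{y}\|_2^2+J(\bm{y})\right\}\quad\text{for every }\bm{x}\in\mathbb{R}^n.$$ The function $S(\cdot,t)$ is called reachable if $I_t(S)$ is nonempty. The backward viscosity solution prior is $$J_{\mathrm{BVS}}(\bm{y})=\sup_{\bm{x}\in\mathbb{R}^n}\left\{S(\bm{x},t)-\tfrac{1}{2t}\|\bm{x}-\bm{y}\|_2^2\right\},\qquad \bm{y}\in\mathbb{R}^n.$$ The convex conjugate of $g\colon\mathbb{R}^n\to\mathbb{R}$ is $g^*(\bm{y})=\sup_{\bm{x}\in\mathbb{R}^n}\{\langle\bm{x},\bm{y}\rangle-g(\bm{x})\}$. *)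

(* Defs.v *)
From mathcomp Require Import all_boot all_order all_algebra.
From mathcomp Require Import all_classical all_reals all_analysis.

Set Implicit Arguments.
Unset Strict Implicit.
Unset Printing Implicit Defensive.

Import Order.TTheory GRing.Theory Num.Theory.

Local Open Scope classical_set_scope.
Local Open Scope ring_scope.

Definition dotp (R : realType) (n : nat) (x y : 'rV[R]_n) : R :=
  \sum_(i < n) x 0 i * y 0 i.

(* The library norm on 'rV[R]_n is the sup norm, hence a separate definition. *)
Definition l2norm (R : realType) (n : nat) (x : 'rV[R]_n) : R :=
  Num.sqrt (dotp x x).

Definition unif_lipschitz (R : realType) (n : nat) (J : 'rV[R]_n -> R) : Prop :=
  exists L : R, forall x y : 'rV[R]_n, `|J x - J y| <= L * l2norm (x - y).

(* Suprema and infima are taken in \bar R, so that no finiteness or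
   boundedness is built into the definitions. *)

Definition lax_oleinik (R : realType) (n : nat) (t : R)
    (J : 'rV[R]_n -> R) (x : 'rV[R]_n) : \bar R :=
  ereal_inf [set ((2 * t)^-1 * l2norm (x - y) ^+ 2 + J y)%:E
            | y in [set: 'rV[R]_n]].

(* I_t(S); the argument S is the time slice S(., t).  The viscosity solution
   of the Hamilton-Jacobi problem with initial value J enters through its
   Lax-Oleinik representation. *)
Definition initial_data (R : realType) (n : nat) (t : R)
    (S : 'rV[R]_n -> R) : set ('rV[R]_n -> R) :=
  [set J | unif_lipschitz J /\
           forall x : 'rV[R]_n, (S x)%:E = lax_oleinik t J x].

Definition reachable (R : realType) (n : nat) (t : R)
    (S : 'rV[R]_n -> R) : Prop :=
  initial_data t S !=set0.

Definition J_BVS (R : realType) (n : nat) (t : R) (S : 'rV[R]_n -> R)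
    (y : 'rV[R]_n) : \bar R :=
  ereal_sup [set (S x - (2 * t)^-1 * l2norm (x - y) ^+ 2)%:E
            | x in [set: 'rV[R]_n]].

Definition convex_conjugate (R : realType) (n : nat) (g : 'rV[R]_n -> R)
    (y : 'rV[R]_n) : \bar R :=
  ereal_sup [set (dotp x y - g x)%:E | x in [set: 'rV[R]_n]].

Definition psi (R : realType) (n : nat) (t : R) (S : 'rV[R]_n -> R)
    (x : 'rV[R]_n) : R :=
  2^-1 * l2norm x ^+ 2 - t * S x.

Definition eps_psi (R : realType) (n : nat) (t : R) (S : 'rV[R]_n -> R)
    (B : set 'rV[R]_n) (psih : 'rV[R]_n -> R) : \bar R :=
  ereal_sup [set `|psih x - psi t S x|%:E | x in B].

Definition J_hat (R : realType) (n : nat) (t : R) (psih : 'rV[R]_n -> R)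
    (y : 'rV[R]_n) : \bar R :=
  ((t^-1)%:E * (convex_conjugate psih y - (2^-1 * l2norm y ^+ 2)%:E))%E.

Definition attains_sup_at (R : realType) (n : nat) (f : 'rV[R]_n -> R)
    (x0 : 'rV[R]_n) : Prop :=
  forall x : 'rV[R]_n, f x <= f x0.

(* Main.v *)
(** Completing the square gives [t * J_BVS = psi^* - |.|^2/2], so that
    [t * (J_hat - J_BVS) = psih^* - psi^*]. Testing each of the two attained
    suprema at the maximizer of the other bounds this difference above by
    [(psi - psih) xh] and below by [(psi - psih) xs]. *)
Require Import Defs.
From mathcomp Require Import all_boot all_order all_algebra.
From mathcomp Require Import all_classical all_reals all_analysis.
From mathcomp Require Import ring lra.

Import Order.TTheory GRing.Theory Num.Theory.

Local Open Scope classical_set_scope.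
Local Open Scope ring_scope.

Lemma sqr_l2norm (R : realType) (n : nat) (x : 'rV[R]_n) :
  l2norm x ^+ 2 = dotp x x.
Proof.
by rewrite sqr_sqrtr// sumr_ge0// => i _; rewrite -expr2 sqr_ge0.
Qed.

Lemma sqr_l2normB (R : realType) (n : nat) (x y : 'rV[R]_n) :
  l2norm (x - y) ^+ 2 = l2norm x ^+ 2 - 2 * dotp x y + l2norm y ^+ 2.
Proof.
rewrite !sqr_l2norm /dotp mulr_sumr -sumrB -big_split /=.
by apply: eq_bigr => i _; rewrite !mxE; ring.
Qed.

Lemma ereal_sup_attained (R : realType) (n : nat) (f : 'rV[R]_n -> R)
    (x0 : 'rV[R]_n) : attains_sup_at f x0 ->
  ereal_sup [set (f x)%:E | x in [set: 'rV[R]_n]] = (f x0)%:E.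
Proof.
move=> fx0; apply/eqP; rewrite eq_le; apply/andP; split.
  by apply: ge_ereal_sup => _ [x _ <-]; rewrite lee_fin.
by apply: ereal_sup_ubound; exists x0.
Qed.

(** Expanding the square, [S x] and the [x]-quadratic term combine into [- psi t S x / t], so [x]
    enters only through the expression maximized in the conjugate of [psi]. *)
Lemma bvs_integrandE (R : realType) (n : nat) (t : R) (S : 'rV[R]_n -> R)
    (x y : 'rV[R]_n) : t != 0 ->
  S x - (2 * t)^-1 * l2norm (x - y) ^+ 2 =
  t^-1 * ((dotp x y - psi t S x) - 2^-1 * l2norm y ^+ 2).
Proof. by move=> t0; rewrite sqr_l2normB /psi; field. Qed.

(** Since [t^-1 > 0], the integrand of [J_BVS] is an increasing affine function of
    [dotp x y - psi t S x]; hence [xs] maximizes it too, and the supremum is finite. *)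
Lemma J_BVS_attained (R : realType) (n : nat) (t : R) (S : 'rV[R]_n -> R)
    (y xs : 'rV[R]_n) : 0 < t ->
  attains_sup_at (fun x => dotp x y - psi t S x) xs ->
  J_BVS t S y =
  (t^-1 * ((dotp xs y - psi t S xs) - 2^-1 * l2norm y ^+ 2))%:E.
Proof.
move=> t0 hxs; have tN0 := lt0r_neq0 t0.
rewrite -bvs_integrandE// /J_BVS.
apply: (@ereal_sup_attained _ _
  (fun x => S x - (2 * t)^-1 * l2norm (x - y) ^+ 2)) => x.
by rewrite !bvs_integrandE// ler_pM2l ?invr_gt0// lerD2r hxs.
Qed.

Lemma J_hat_attained (R : realType) (n : nat) (t : R) (psih : 'rV[R]_n -> R)
    (y xh : 'rV[R]_n) : attains_sup_at (fun x => dotp x y - psih x) xh ->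
  J_hat t psih y = (t^-1 * ((dotp xh y - psih xh) - 2^-1 * l2norm y ^+ 2))%:E.
Proof.
by move=> hxh; rewrite /J_hat /convex_conjugate (ereal_sup_attained _ _ _ _ hxh).
Qed.

Theorem proposition4p4 (R : realType) (n : nat) (t : R) (ht : 0 < t)
    (S : 'rV[R]_n -> R) (hS : reachable t S)
    (B : set 'rV[R]_n) (psih : 'rV[R]_n -> R)
    (heps : (eps_psi t S B psih < +oo)%E)
    (y xs xh : 'rV[R]_n)
    (hxsB : B xs) (hxs : attains_sup_at (fun x => dotp x y - psi t S x) xs)
    (hxhB : B xh) (hxh : attains_sup_at (fun x => dotp x y - psih x) xh) :
  (`|J_hat t psih y - J_BVS t S y|
     <= (t^-1 * Num.max `|psih xs - psi t S xs| `|psih xh - psi t S xh|)%:E)%E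
  /\
  ((t^-1 * Num.max `|psih xs - psi t S xs| `|psih xh - psi t S xh|)%:E
     <= (t^-1)%:E * eps_psi t S B psih)%E.
Proof.
have tV0 : 0 < t^-1 by rewrite invr_gt0.
split.
  rewrite (J_hat_attained _ _ _ _ _ _ hxh) (J_BVS_attained _ _ _ _ _ _ ht hxs).
  rewrite -EFinB abse_EFin lee_fin -mulrBr normrM gtr0_norm// ler_pM2l//.
  have /= hs := hxs xh; have /= hh := hxh xs.
  (* The sign of the difference of the two conjugates selects the entry of the maximum: if it is
     nonnegative, [hs] bounds it by the error at [xh]; otherwise [hh] bounds its opposite by the
     error at [xs]. *)
  rewrite le_max; case: (leP (dotp xs y - psi t S xs) (dotp xh y - psih xh)) => h.
    apply/orP; right; rewrite [leLHS]ger0_norm; last lra.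
    by rewrite distrC; apply: le_trans (ler_norm _); lra.
  apply/orP; left; rewrite [leLHS]ler0_norm; last lra.
  by apply: le_trans (ler_norm _); lra.
rewrite EFinM lee_wpmul2l//; first by rewrite lee_fin ltW.
(* Whichever entry is the larger, it is the error at a point of [B], hence a member of the set whose
   supremum is [eps_psi]. *)
rewrite /eps_psi /Num.max; case: ifP => _; apply: ereal_sup_ubound.
  by exists xh.
by exists xs.
Qed.
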